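(* Let $\mathcal{A}$ be a central essential arrangement of hyperplanes in $\mathbb{R}^r$, $r\ge 2$. Then $\mathcal{A}$ is simplicial (all connected components of $\mathbb{R}^r\setminus\bigcup_{H\in\mathcal{A}}H$ are open simplicial cones) if and only if \[ r\,\chi_{\mathcal{A}}(-1)+2\sum_{H\in\mathcal{A}}\chi_{\mathcal{A}^H}(-1)=0. \]
   Context: An arrangement of hyperplanes is a finite set of hyperplanes; central means all hyperplanes are linear subspaces, and a central arrangement is essential if the intersection of all its hyperplanes is $0$. The intersection lattice $L(\mathcal{A})$ of an arrangement $\mathcal{A}$ in $V$ is the set of all intersections of elements of $\mathcal{A}$ (including $V$ as the empty intersection), ordered by reverse inclusion. The characteristic polynomial is $\chi_{\mathcal{A}}(t)=\sum_{X\in L(\mathcal{A})}\mu(X)t^{\dim X}$, where $\mu(X)=\mu(V,X)$ is the Möbius function of $L(\mathcal{A})$. For $X\in L(\mathcal{A})$ the restriction is $\mathcal{A}^X=\{X\cap H\mid H\in\mathcal{A},\ X\not\subseteq H,\ X\cap H\neq\emptyset\}$, an arrangement in $X$. *)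

(* Defs.v *)
From HB Require Import structures.
From mathcomp Require Import all_boot all_order all_algebra finmap.
From mathcomp Require Import all_classical all_reals all_analysis.

Set Implicit Arguments.
Unset Strict Implicit.
Unset Printing Implicit Defensive.

Import Order.TTheory GRing.Theory Num.Theory.
Import numFieldNormedType.Exports.

Local Open Scope classical_set_scope.
Local Open Scope ring_scope.

Section Mobius.
Variables (T : choiceType) (le : rel T) (L : {fset T}).

(* mobius_rec runs the recursion mu(x, x) = 1,
   mu(x, y) = - \sum_(x <= z < y) mu(x, z) on explicit fuel; chains of L have
   at most #|` L| elements, so this much fuel suffices: see mobiusE. *)
Fixpoint mobius_rec (n : nat) (x y : T) : int :=
  if n is n'.+1 then
    if x == y then 1
    else - \sum_(z <- L | [&& le x z, le z y & z != y]) mobius_rec n' x z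
  else 0.

Definition mobius (x y : T) : int := mobius_rec #|` L| x y.

Hypothesis le_refl : reflexive le.
Hypothesis le_anti : antisymmetric le.
Hypothesis le_trans : transitive le.

Let height (y : T) : nat := count (le^~ y) L.

Let height_lt z y : y \in L -> le z y -> z != y -> (height z < height y)%N.
Proof.
move=> yL zy neq; rewrite /height.
have -> : count (le^~ y) L =
    (count (le^~ z) L + count (fun w => le w y && ~~ le w z) L)%N.
  rewrite -count_predUI -[LHS]addn0; congr addn.
    apply: eq_count => w /=.
    by case wz : (le w z) => /=; [rewrite (le_trans wz zy) | rewrite andbT].
  by rewrite (eq_count (a2 := pred0)) ?count_pred0 // => w /=; case: (le w z);
     rewrite /= ?andbF.
rewrite -[ltnLHS]addn0 ltn_add2l -has_count; apply/hasP; exists y => //=.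
rewrite le_refl /=; apply/negP => yz.
by move/negP: neq; apply; apply/eqP/le_anti; rewrite zy yz.
Qed.

Let mobius_rec_stable n m x y : y \in L ->
  (height y <= n)%N -> (height y <= m)%N -> mobius_rec n x y = mobius_rec m x y.
Proof.
have pos w : w \in L -> (0 < height w)%N.
  by move=> wL; rewrite -has_count; apply/hasP; exists w.
elim: n m y => [|n IH] [|m] y yL hn hm //=; try by have := pos _ yL;
  rewrite ltnNge ?hn ?hm.
case: eqP => // _; congr (- _); rewrite big_seq_cond [RHS]big_seq_cond.
apply: eq_bigr => z /andP[zL /and3P[_ zy neq]].
have zlt := height_lt yL zy neq.
by apply: IH => //; rewrite -ltnS; apply: leq_trans zlt _.
Qed.

Lemma mobiusE x y : y \in L ->
  mobius x y = if x == y then 1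
               else - \sum_(z <- L | [&& le x z, le z y & z != y]) mobius x z.
Proof.
move=> yL; have hs w : (height w <= #|` L|)%N by apply: count_size.
rewrite {1}/mobius (@mobius_rec_stable _ #|` L|.+1 x y yL) ?leqW //.
Qed.

End Mobius.

Section Arrangements.
Variables (K : fieldType) (E : vectType K).
Implicit Types (V X H : {vspace E}) (A : {fset {vspace E}}).

Definition linear_hyperplane V H : bool :=
  (H <= V)%VS && ((\dim H).+1 == \dim V).

Definition central_arrangement V A : Prop :=
  forall H, H \in A -> linear_hyperplane V H.

(* The empty intersection is the ambient space V. *)
Definition arr_meet V A : {vspace E} := (V :&: \bigcap_(H <- A) H)%VS.

Definition essential V A : Prop := arr_meet V A = 0%VS.

Definition intersection_lattice V A : {fset {vspace E}} :=
  [fset arr_meet V B | B in fpowerset A]%fset.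

Definition reverse_inclusion : rel {vspace E} := fun X Y => (Y <= X)%VS.

Definition char_poly_arr V A : {poly int} :=
  \sum_(X <- intersection_lattice V A)
     mobius reverse_inclusion (intersection_lattice V A) V X *: 'X^(\dim X).

(* The condition that X meets H is void here: both contain 0. *)
Definition restriction A X : {fset {vspace E}} :=
  [fset (X :&: H)%VS | H in A & ~~ (X <= H)%VS]%fset.

Lemma reverse_inclusion_refl : reflexive reverse_inclusion.
Proof. by move=> X; apply: subvv. Qed.

Lemma reverse_inclusion_anti : antisymmetric reverse_inclusion.
Proof. by move=> X Y XY; apply/eqP; rewrite eqEsubv andbC. Qed.

Lemma reverse_inclusion_trans : transitive reverse_inclusion.
Proof. by move=> Y X Z YX ZY; apply: subv_trans ZY YX. Qed.

End Arrangements.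

Section Simplicial.
Variables (R : realType) (r : nat).
Implicit Types (A : {fset {vspace 'rV[R]_r}}) (C : set 'rV[R]_r).

Definition arr_complement A : set 'rV[R]_r :=
  ~` [set x | exists2 H, H \in A & x \in H].

Definition chamber A C : Prop :=
  exists2 x, arr_complement A x & C = connected_component (arr_complement A) x.

Definition open_simplicial_cone C : Prop :=
  exists2 b : r.-tuple 'rV[R]_r, basis_of fullv b &
    C = [set x | exists2 a : 'I_r -> R,
           (forall i, 0 < a i) & x = \sum_(i < r) a i *: b`_i].

Definition simplicial A : Prop :=
  forall C, chamber A C -> open_simplicial_cone C.

End Simplicial.

(* Main.v *)
Require Import Defs.
From HB Require Import structures.
From mathcomp Require Import all_boot all_order all_algebra finmap.
From mathcomp Require Import all_classical all_reals all_analysis.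
From mathcomp Require Import ring lra zify.

(** By Zaslavsky's theorem, (-1)^r chi_A(-1) is the number of chambers of A, and
    (-1)^(r-1) chi_{A^H}(-1) is the number of chambers of the restriction to H.
    The latter are the facets of chambers of A that lie on H, and each of them
    is a facet of exactly two chambers. Hence, up to the sign (-1)^r, the
    left-hand side of the equation is

      sum over the chambers C of (r - number of facets of C).

    As A is essential, the facet forms of a chamber span the dual space, so
    every chamber has at least r facets, and the sum vanishes if and only if
    every chamber has exactly r of them. If it has exactly r, the facet forms
    are a basis of the dual space and the chamber is spanned by the dual basis;
    conversely an open simplicial cone has at most r facets.

    Chambers are encoded by the sign vectors realized by a choice of linear
    forms defining the hyperplanes; [component_region] identifies them with the
    connected components of the complement. Zaslavsky's theorem ([zaslavsky])
    results from comparing deletion-restriction for sign vectors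
    ([nregions_rec]) with deletion-restriction for the alternating sum over
    subarrangements to which the characteristic polynomial is equal by Whitney's
    theorem ([char_poly_whitney]). The geometry of facets is in [cone_facets],
    [card_facets_ge], [facets_simplicial] and [card_facets_simplicial], and
    [sum_card_facets] is the double counting. *)

Set Implicit Arguments.
Unset Strict Implicit.
Unset Printing Implicit Defensive.

Import Order.TTheory GRing.Theory Num.Theory.
Import numFieldNormedType.Exports.

Local Open Scope ring_scope.

(** * Whitney's formula for the characteristic polynomial *)

Section Whitney.
Variables (K : fieldType) (E : vectType K).
Implicit Types (V X Y H : {vspace E}) (s : seq {vspace E}).
Implicit Types (A : {fset {vspace E}}) (F G : {vspace E} -> int).

(** The sum of (-1)^|B| F (V :&: \bigcap B) over the subsequences B of s,
    written in the deletion-restriction form in which it is used: the first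
    hyperplane is either left out or intersected with V. *)
Fixpoint whitney_sum F V s : int :=
  if s is H :: s' then whitney_sum F V s' - whitney_sum F (V :&: H)%VS s'
  else F V.

Lemma eq_whitney_sum (P : {vspace E} -> bool) F G V s :
  {in P, F =1 G} -> P V -> (forall X H, P X -> H \in s -> P (X :&: H)%VS) ->
  whitney_sum F V s = whitney_sum G V s.
Proof.
move=> FG; elim: s V => [|H s IH] V PV Pcap /=; first exact: FG.
have Pcap' X H' : P X -> H' \in s -> P (X :&: H')%VS.
  by move=> PX H's; apply: Pcap; rewrite // inE H's orbT.
by rewrite !IH // Pcap ?mem_head.
Qed.

Lemma whitney_sum_sum (I : Type) (t : seq I) (P : pred I) (a : I -> int)
    (F : I -> {vspace E} -> int) V s :
  whitney_sum (fun X => \sum_(i <- t | P i) a i * F i X) V s =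
  \sum_(i <- t | P i) a i * whitney_sum (F i) V s.
Proof.
elim: s V => [//|H s IH] V /=; rewrite !IH -sumrB.
by apply: eq_bigr => i _; rewrite mulrBr.
Qed.

(** Inclusion-exclusion: the subsequences counted are those of the hyperplanes
    of s that contain X, and their signs cancel as soon as there is one. *)
Lemma whitney_sum_sup V s X :
  whitney_sum (fun Y => (X <= Y)%VS%:R) V s =
  ((X <= V)%VS && ~~ has (fun H => (X <= H)%VS) s)%:R.
Proof.
elim: s V => [|H s IH] V /=; first by rewrite andbT.
rewrite !IH subv_cap.
by case: (X <= V)%VS; case: (X <= H)%VS; case: (has _ s);
   rewrite ?subr0 ?subrr.
Qed.

(** Lets an arrangement be replaced by its trace on V, which is how restrictions
    of arrangements are reached. *)
Lemma whitney_sum_map_cap F U V s : (U <= V)%VS ->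
  whitney_sum F U [seq (V :&: H)%VS | H <- s] = whitney_sum F U s.
Proof.
elim: s U => [//|H s IH] U UV /=.
by rewrite capvA (capv_idPl UV) !IH // (subv_trans _ UV) // capvSl.
Qed.

Lemma mem_arr_meet V A v :
  (v \in arr_meet V A) = (v \in V) && all (fun H => v \in H) A.
Proof.
rewrite /arr_meet memv_cap; congr (_ && _).
elim: (enum_fset A) => [|H s IH]; first by rewrite big_nil memvf.
by rewrite big_cons memv_cap IH.
Qed.

Lemma mem_lattice V A X :
  reflect (exists2 B : {fset {vspace E}}, (B `<=` A)%fset & X = arr_meet V B)
          (X \in intersection_lattice V A).
Proof.
apply: (iffP (imfsetP _ _ _ _)) => /= -[B].
  by rewrite fpowersetE => BA ->; exists B.
by move=> BA ->; exists B; rewrite ?fpowersetE.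
Qed.

Lemma lattice_ambient V A : V \in intersection_lattice V A.
Proof.
apply/mem_lattice; exists fset0; first exact: fsub0set.
by rewrite /arr_meet big_nil capvf.
Qed.

Lemma lattice_cap V A X H : X \in intersection_lattice V A -> H \in A ->
  (X :&: H)%VS \in intersection_lattice V A.
Proof.
move=> /mem_lattice[B BA ->] HA; apply/mem_lattice.
exists (H |` B)%fset; first by rewrite fsubUset fsub1set HA.
apply/vspaceP => v; rewrite memv_cap !mem_arr_meet -andbA; congr (_ && _).
apply/andP/allP => [[/allP vB vH] H'|vHB].
  by rewrite in_fset1U => /orP[/eqP->|/vB].
split; last by apply: vHB; rewrite fset1U1.
by apply/allP => H' H'B; apply: vHB; rewrite fset1Ur.
Qed.

Lemma lattice_sub V A X : X \in intersection_lattice V A -> (X <= V)%VS.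
Proof. by move=> /mem_lattice[B _ ->]; apply: capvSl. Qed.

(** A flat other than V is an intersection of at least one hyperplane. *)
Lemma lattice_proper V A X : X \in intersection_lattice V A -> X != V ->
  has (fun H => (X <= H)%VS) A.
Proof.
move=> /mem_lattice[B BA ->] neq; case: (fset_0Vmem B) => [B0|[H HB]].
  by move: neq; rewrite B0 /arr_meet big_nil capvf eqxx.
apply/hasP; exists H; first exact: (fsubsetP BA).
by apply/subvP => v; rewrite mem_arr_meet => /andP[_ /allP->].
Qed.

Lemma sum_delta (T : eqType) (t : seq T) (c : T -> int) z : uniq t -> z \in t ->
  \sum_(y <- t) c y * (z == y)%:R = c z.
Proof.
move=> ut zt; rewrite (bigD1_seq z) //= eqxx mulr1 big1 ?addr0 // => y.
by rewrite eq_sym => /negPf->; rewrite mulr0.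
Qed.

(** Subsequences with the same intersection are grouped together; linearity of
    the Whitney sum in its weight does this without naming the subsequences. *)
Lemma whitney_sum_by_flat V A s c : central_arrangement V A -> s =i A ->
  whitney_sum c V s =
  \sum_(Y <- intersection_lattice V A)
    c Y * whitney_sum (fun Z => (Z == Y)%:R) V s.
Proof.
move=> cA sA; rewrite -whitney_sum_sum.
apply: (@eq_whitney_sum (mem (intersection_lattice V A)))
  => [Z ZL|/=|Y H /= YL].
- by rewrite sum_delta.
- exact: lattice_ambient.
- by rewrite sA; apply: lattice_cap.
Qed.

(** The signed number of ways to obtain a flat as an intersection satisfies the
    recursion that defines the Moebius function: summed over the flats above X
    it gives 1 if X = V and 0 otherwise, by [whitney_sum_sup]. The sequence s
    may list a hyperplane several times, since only its members matter there. *)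
Lemma mobius_whitney V A s X : central_arrangement V A -> s =i A ->
  X \in intersection_lattice V A ->
  mobius (@reverse_inclusion K E) (intersection_lattice V A) V X =
  whitney_sum (fun Y => (Y == X)%:R) V s.
Proof.
move=> cA sA; set L := intersection_lattice V A.
have [n] := ubnP (\dim V - \dim X).
elim: n X => [//|n IH] X ltn XL.
rewrite (mobiusE (@reverse_inclusion_refl K E) (@reverse_inclusion_anti K E)
          (@reverse_inclusion_trans K E)) //.
have XV := lattice_sub XL.
have sup0 : \sum_(Y <- L | (X <= Y)%VS) whitney_sum (fun Z => (Z == Y)%:R) V s
    = (X == V)%:R.
  transitivity (whitney_sum (fun Z => (X <= Z)%VS%:R) V s).
    rewrite (whitney_sum_by_flat _ cA sA) big_mkcond; apply: eq_bigr => Y _.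
    by case: ifP => _; rewrite ?mul1r ?mul0r.
  rewrite whitney_sum_sup XV (eq_has_r sA) /=.
  have [->|XneqV] := eqVneq X V; last by rewrite (lattice_proper XL XneqV).
  case: hasP => // -[H HA]; have /andP[HV /eqP dH] := cA _ HA.
  by move/dimvS; rewrite -dH ltnn.
rewrite -big_filter (bigD1_seq X) ?filter_uniq ?fset_uniq ?mem_filter ?subvv //=
  in sup0.
rewrite big_filter_cond /= in sup0.
have [VX|neq] := eqVneq V X.
  rewrite -VX eqxx in sup0 *; rewrite -[LHS]/(true%:R) -sup0.
  rewrite big_seq_cond big_pred0 ?addr0 // => Y.
  apply/negP => /and3P[/lattice_sub YV VY /negP[]].
  by rewrite eqEsubv YV.
rewrite eq_sym (negPf neq) in sup0.
apply/eqP; rewrite eq_sym -addr_eq0 -[X in _ == X]sup0; apply/eqP; congr +%R.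
rewrite big_seq_cond [RHS]big_seq_cond; apply: eq_big => [Y|Y].
  by case YL: (Y \in L) => //=; rewrite /reverse_inclusion (lattice_sub YL).
rewrite /reverse_inclusion => /and4P[YL YV XY neqXY]; apply: IH => //.
have ltd : (\dim X < \dim Y)%N.
  rewrite ltn_neqAle dimvS // andbT.
  apply: contraNneq neqXY => dXY; suff : X == Y by rewrite eq_sym.
  by rewrite eqEdim XY dXY leqnn.
have := dimvS YV; lia.
Qed.

Lemma char_poly_whitney V A s (t : int) : central_arrangement V A -> s =i A ->
  (char_poly_arr V A).[t] = whitney_sum (fun X => t ^+ \dim X) V s.
Proof.
move=> cA sA; rewrite (whitney_sum_by_flat _ cA sA) /char_poly_arr horner_sum.
rewrite big_seq [RHS]big_seq; apply: eq_bigr => X XL.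
by rewrite hornerZ hornerXn (mobius_whitney cA sA XL) mulrC.
Qed.

Lemma dim_cap_hyperplane U H X : linear_hyperplane U H -> (X <= U)%VS ->
  ~~ (X <= H)%VS -> (\dim (X :&: H)).+1 = \dim X.
Proof.
move=> /andP[HU /eqP dH] XU nXH.
have le : (\dim (X + H) <= \dim U)%N by apply: dimvS; rewrite subv_add XU.
have lt : (\dim H < \dim (X + H))%N.
  rewrite ltn_neqAle dimvS ?addvSr // andbT; apply: contraNneq nXH => dE.
  have /eqP-> : H == (X + H)%VS by rewrite eqEdim addvSr dE leqnn.
  exact: addvSl.
have := dimv_sum_cap X H; lia.
Qed.

(** Distinct members of A may have the same trace on H, so that the traces of s
    form a list with repetitions of the restricted arrangement; this is harmless
    in [char_poly_whitney], and the traces may then be undone. *)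
Lemma char_poly_restriction U A H s (t : int) : central_arrangement U A ->
  H \in A -> s =i [predD1 A & H] ->
  (char_poly_arr H (restriction A H)).[t] =
  whitney_sum (fun X => t ^+ \dim X) H s.
Proof.
move=> cA HA sA; have /andP[HU /eqP dH] := cA _ HA.
have nsub K' : K' \in A -> (H <= K')%VS = (K' == H).
  move=> K'A; have /andP[K'U /eqP dK'] := cA _ K'A.
  by rewrite eq_sym eqEdim -[(_ <= \dim H)%N]ltnS dH dK' leqnn andbT.
rewrite -(@whitney_sum_map_cap _ H H) //; apply: char_poly_whitney.
  move=> X /imfsetP[K' /=]; rewrite inE => /andP[K'A HK'] ->.
  by rewrite /linear_hyperplane capvSl /= (dim_cap_hyperplane (cA _ K'A)).
move=> X; apply/mapP/imfsetP => -[K' /=].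
  by rewrite sA inE => /andP[neq K'A] ->; exists K'; rewrite // inE K'A nsub.
rewrite inE => /andP[K'A]; rewrite nsub // => neq ->.
by exists K'; rewrite // sA inE neq.
Qed.

End Whitney.

(** * Counting sign vectors: Zaslavsky's theorem *)

Section SignVectors.
Variables (R : realFieldType) (r : nat) (I : finType).
Variables (f : I -> 'cV[R]_r).
Implicit Types (x y d : 'rV[R]_r) (s : {ffun I -> bool}) (b : bool) (i j k : I).

Definition form (u : 'cV[R]_r) x : R := (x *m u) 0 0.

Lemma formD u x y : form u (x + y) = form u x + form u y.
Proof. by rewrite /form mulmxDl mxE. Qed.

Lemma formZ u a x : form u (a *: x) = a * form u x.
Proof. by rewrite /form -scalemxAl mxE. Qed.

Lemma formN u x : form u (- x) = - form u x.
Proof. by rewrite -scaleN1r formZ mulN1r. Qed.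

Lemma formZl u a x : form (a *: u) x = a * form u x.
Proof. by rewrite /form -scalemxAr mxE. Qed.

(** Serves to move a point off a hyperplane without leaving the open half-spaces
    that contain it. *)
Lemma perturb_pos (T : eqType) (t : seq T) (a c : T -> R) :
  (forall z : T, z \in t -> 0 < a z) ->
  exists2 e, 0 < e & forall z : T, z \in t -> 0 < a z + e * c z.
Proof.
move=> apos.
suff [e e0 eP] : exists2 e, 0 < e &
    forall z : T, z \in t -> forall e', 0 < e' -> e' <= e -> 0 < a z + e' * c z.
  by exists e => // j jt; apply: eP.
elim: t apos => [|z t IH] apos; first by exists 1.
have [w wt|e e0 eP] := IH; first by apply: apos; rewrite inE wt orbT.
have az : 0 < a z by apply: apos; rewrite mem_head.
have c0 : 0 < 1 + `|c z| by rewrite ltr_wpDr.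
exists (Num.min e (a z / (1 + `|c z|))).
  by rewrite lt_min e0 divr_gt0.
move=> w; rewrite inE => /orP[/eqP-> | wt] e' e'0;
  rewrite le_min => /andP[ee ea].
  rewrite ler_pdivlMr // in ea.
  have : - `|c z| <= c z by rewrite lerNl ler_normr lexx orbT.
  nra.
exact: eP.
Qed.

Definition side_value s j x : R := form ((-1) ^+ s j *: f j) x.

Definition realized (V : {vspace 'rV[R]_r}) (js : seq I) s : Prop :=
  exists2 x, x \in V & forall j, j \in js -> 0 < side_value s j x.

(** The signs at indices outside js are unconstrained, so each region of the
    arrangement js on V is counted 2 ^ (#|I| - size js) times. Keeping full sign
    vectors avoids dependent index types and gives directly the count of
    facets, which determine a sign vector up to the sign at one index. *)
Definition nregions V js : nat :=
  #|[set s : {ffun I -> bool} | `[< realized V js s >]]|.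

Definition flip i s : {ffun I -> bool} := [ffun k => (k == i) (+) s k].

Lemma flipK i : involutive (flip i).
Proof. by move=> s; apply/ffunP => k; rewrite !ffunE addbA addbb. Qed.

Lemma card_flip i b (U : {set {ffun I -> bool}}) :
  (forall s, (flip i s \in U) = (s \in U)) ->
  #|U| = (2 * #|[set s : {ffun I -> bool} in U | s i == b]|)%N.
Proof.
move=> Uf; rewrite -(cardsID [set s : {ffun I -> bool} | s i == b] U).
rewrite mul2n -addnn; congr addn.
  by apply: eq_card => s; rewrite !inE.
rewrite -(card_imset _ (can_inj (flipK i))); apply: eq_card => s.
rewrite -[in LHS](flipK i s) mem_imset ?inE; last exact: can_inj (flipK i).
by rewrite Uf ffunE eqxx andbC; case: (s i); case: b.
Qed.

Variable (H : I -> {vspace 'rV[R]_r}).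
Hypothesis HP : forall i x, (x \in H i) = (form (f i) x == 0).

(** Deletion-restriction for regions. A region of js is met by at least one
    open side of H j, and by both sides exactly when it meets H j, so the two
    sides together meet as many regions as there are for js on V and on
    V :&: H j. The factor 2 accounts for the sign at j, which is free on the
    right-hand side and prescribed on the left. *)
Lemma nregions_rec V j js : j \notin js -> ~~ (V <= H j)%VS ->
  (2 * nregions V (j :: js) = nregions V js + nregions (V :&: H j) js)%N.
Proof.
move=> jjs /subvPn[d dV]; rewrite HP => dj.
pose halfreal b s := exists x,
  [/\ x \in V, forall k, k \in js -> 0 < side_value s k x
  & 0 < form ((-1) ^+ b *: f j) x].
pose U b := [set s : {ffun I -> bool} | `[< halfreal b s >]].
have -> : nregions V (j :: js) =
    (#|[set s : {ffun I -> bool} in U true | s j == true]|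
     + #|[set s : {ffun I -> bool} in U false | s j == false]|)%N.
  rewrite /nregions -(cardsID [set s : {ffun I -> bool} | s j]).
  congr addn; apply: eq_card => s;
    rewrite !inE; [rewrite andbC|]; case sj: (s j); rewrite ?andbF //= ?andbT;
    apply: asbool_equiv_eq; split.
  - case=> x xV xP; exists x; split=> // [k kjs|].
      by apply: xP; rewrite inE kjs orbT.
    by have := xP _ (mem_head _ _); rewrite /side_value sj.
  - case=> x [xV xP xj]; exists x => // k; rewrite inE => /orP[/eqP->|/xP//].
    by rewrite /side_value sj.
  - case=> x xV xP; exists x; split=> // [k kjs|].
      by apply: xP; rewrite inE kjs orbT.
    by have := xP _ (mem_head _ _); rewrite /side_value sj.
  - case=> x [xV xP xj]; exists x => // k; rewrite inE => /orP[/eqP->|/xP//].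
    by rewrite /side_value sj.
have Uflip b s : (flip j s \in U b) = (s \in U b).
  rewrite !inE; apply: asbool_equiv_eq.
  suff imp s' : halfreal b s' -> halfreal b (flip j s').
    by split=> [/imp|/imp //]; rewrite flipK.
  case=> x [xV xP xj]; exists x; split=> // k kjs.
  have := xP _ kjs; rewrite /side_value ffunE; case: eqP => // kj.
  by rewrite -kj kjs in jjs.
rewrite mulnDr -!card_flip // -cardsUI; congr addn; apply: eq_card => s;
  rewrite !inE -?asbool_or -?asbool_and; apply: asbool_equiv_eq; split.
- by case=> -[x [xV xP _]]; exists x.
- case=> x xV xP.
  have gen y : y \in V -> (forall k, k \in js -> 0 < side_value s k y) ->
      form (f j) y != 0 -> halfreal true s \/ halfreal false s.
    move=> yV yP; rewrite neq_lt => /orP[lt|gt]; [left|right];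
      exists y; split=> //.
      by rewrite formZl expr1 mulN1r oppr_gt0.
    by rewrite formZl expr0 mul1r.
  have [xj0|] := eqVneq (form (f j) x) 0; last exact: gen.
  have [e e0 eP] := perturb_pos (fun k => side_value s k d) xP.
  apply: (gen (x + e *: d)); first by rewrite memvD ?memvZ.
    by move=> k /eP; rewrite /side_value formD formZ.
  by rewrite formD formZ xj0 add0r mulf_neq0 // gt_eqF.
- case=> -[x [xV xP xj]] [y [yV yP yj]].
  rewrite formZl expr1 mulN1r oppr_gt0 in xj.
  rewrite formZl expr0 mul1r in yj.
  exists (form (f j) y *: x + (- form (f j) x) *: y).
    rewrite memv_cap memvD ?memvZ //= HP formD !formZ; apply/eqP; ring.
  move=> k kjs; rewrite /side_value formD !formZ.
  by rewrite addr_gt0 // mulr_gt0 ?oppr_gt0 //; [apply: xP|apply: yP].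
- case=> x; rewrite memv_cap HP => /andP[xV /eqP xj] xP.
  have half b y : y \in V -> 0 < form ((-1) ^+ b *: f j) y -> halfreal b s.
    move=> yV yj.
    have [e e0 eP] := perturb_pos (fun k => side_value s k y) xP.
    exists (x + e *: y); split; first by rewrite memvD ?memvZ.
      by move=> k /eP; rewrite /side_value formD formZ.
    by rewrite formD !formZ formZl xj mulr0 add0r mulr_gt0.
  move: dj; rewrite neq_lt => /orP[lt|gt].
  + split; [apply: (half true d) | apply: (half false (- d))] => //.
    * by rewrite formZl expr1 mulN1r oppr_gt0.
    * by rewrite rpredN.
    * by rewrite formZl expr0 mul1r formN oppr_gt0.
  + split; [apply: (half true (- d)) | apply: (half false d)] => //.
    * by rewrite rpredN.
    * by rewrite formZl expr1 formN mulrNN mul1r.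
    * by rewrite formZl expr0 mul1r.
Qed.

Lemma nregions_nil V : nregions V [::] = (2 ^ #|I|)%N.
Proof.
rewrite -card_bool -card_ffun; apply: eq_card => s; rewrite !inE.
by apply/asboolP; exists 0; rewrite ?mem0v.
Qed.

Lemma nregions_sup V js :
  has (fun j => (V <= H j)%VS) js -> nregions V js = 0%N.
Proof.
case/hasP => j jjs VH; apply: eq_card0 => s; rewrite !inE; apply/asboolP.
case=> x xV /(_ _ jjs); have := subvP VH _ xV; rewrite HP => /eqP xj.
by rewrite /side_value formZl xj mulr0 ltxx.
Qed.

Hypothesis hH : forall i, linear_hyperplane fullv (H i).

(** Both sides obey the same deletion-restriction recursion: if V is not
    contained in H j, intersecting with H j lowers the dimension by 1, which
    turns the minus sign of the Whitney sum into a plus; if V is contained in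
    H j, both sides vanish. *)
Lemma zaslavsky V js : uniq js ->
  (2 ^ size js * nregions V js)%:R =
  (2 ^ #|I|)%:R *
    ((-1) ^+ \dim V * whitney_sum (fun X => (-1) ^+ \dim X) V (map H js)).
Proof.
elim: js V => [|j js IH] V /=.
  by rewrite nregions_nil mul1n -exprD addnn -mul2n exprM sqrrN expr1n mulr1.
case/andP => jjs ujs; have [VH|nVH] := boolP (V <= H j)%VS.
  by rewrite nregions_sup /= ?VH // muln0 (capv_idPl VH) subrr !mulr0.
rewrite expnSr -mulnA nregions_rec // mulnDr natrD !IH //.
rewrite -(dim_cap_hyperplane (hH j) (subvf V) nVH) !exprS.
ring.
Qed.

End SignVectors.

(** * Facets of a pointed polyhedral cone *)

Section Facets.
Variables (R : realFieldType) (r : nat) (I : finType).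
Variables (g : I -> 'cV[R]_r).
Implicit Types (x y d : 'rV[R]_r) (j k : I) (J : {set I}).

Definition cone J x : Prop := forall j, j \in J -> 0 < form (g j) x.

Definition facet k : Prop :=
  exists2 x, form (g k) x = 0 & forall j, j != k -> 0 < form (g j) x.

Definition facets : {set I} := [set k | `[< facet k >]].

(** A point in the relative interior of a facet has some nonpositive coordinate
    in the basis b, since it is not in the open cone. Two facets cannot share
    this coordinate: the sum of two such points lies in the open cone, where all
    coordinates are positive. This injects the facets into the r coordinates. *)
Lemma card_facets_simplicial (b : r.-tuple 'rV[R]_r) : basis_of fullv b ->
  (forall x, cone [set: I] x <->
     exists2 a : 'I_r -> R,
       (forall i, 0 < a i) & x = \sum_(i < r) a i *: b`_i) ->
  (#|facets| <= r)%N.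
Proof.
move=> bB coneP.
have fb : free b by apply: basis_free bB.
have ex (k : {k | k \in facets}) : exists i : 'I_r, exists x,
   [/\ form (g (val k)) x = 0, forall j, j != val k -> 0 < form (g j) x
     & coord b i x <= 0].
  case: k => k /=; rewrite inE => /asboolP[x xk xP].
  have [[i xi]|none] := pselect (exists i, coord b i x <= 0).
    by exists i, x.
  have : cone [set: I] x.
    apply/coneP; exists (fun i => coord b i x).
      by move=> i; rewrite ltNge; apply/negP => xi; apply: none; exists i.
    exact: coord_basis bB (memvf x).
  by move/(_ k (finset.in_setT _)); rewrite xk ltxx.
have [h hP] := choice ex.
have -> : #|facets| = #|{: {k | k \in facets}}| by rewrite card_sig.
rewrite -[leqRHS]card_ord; apply: (@leq_card _ _ h) => k l hkl.
apply/eqP/negPn/negP => kl.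
have [x [xk xP xi]] := hP k; have [y [yl yP yi]] := hP l.
have : cone [set: I] (x + y).
  move=> j _; rewrite formD.
  have [jk|jk] := eqVneq j (val k).
    by rewrite jk xk add0r; apply: yP.
  have [jl|jl] := eqVneq j (val l).
    by rewrite jl yl addr0; apply: xP; rewrite -jl.
  by rewrite addr_gt0 ?xP ?yP.
case/coneP => a a0 xy.
have : coord b (h k) (x + y) = a (h k) by rewrite xy coord_sum_free.
move=> E; have := a0 (h k); rewrite -E linearD /= ltNge.
by rewrite -[leRHS]addr0 lerD // hkl.
Qed.

(** Non-proportionality of g i and g k in the form in which it is used: the
    kernel of g k contains a direction along which g i decreases. *)
Hypothesis g_indep : forall i k, i != k ->
  exists2 d, form (g k) d = 0 & form (g i) d < 0.
Hypothesis g_ess : forall v, (forall i, form (g i) v = 0) -> v = 0.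
Variable x0 : 'rV[R]_r.
Hypothesis x0P : cone [set: I] x0.

(** The facets cut out the cone. Take a minimal set J of inequalities defining
    the cone. Dropping k from J enlarges the cone, so the segment from x0 to a
    new point meets the kernel of g k where the other inequalities of J hold;
    this gives a relatively open piece of that kernel contained in the closed
    cone. Every other form is nonnegative on this piece and, not being
    proportional to g k, positive on it. Hence J consists of facets. *)
Lemma cone_facets x : cone facets x -> cone [set: I] x.
Proof.
pose P J := `[< forall y, cone J y -> cone [set: I] y >].
have [|J /minsetP[/asboolP JP Jmin] _] := @minset_exists _ P [set: I].
  exact/asboolP.
suff JF : J \subset facets.
  by move=> xF; apply: JP => j /(fintype.subsetP JF)/xF.
apply/fintype.subsetP => k kJ; rewrite inE; apply/asboolP.
have : ~~ P (J :\ k).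
  apply/negP => /Jmin/(_ (finset.subsetDl _ _)) Jk.
  by have := kJ; rewrite -Jk !inE eqxx.
move/asboolPn/existsNP => [y /not_implyP[yJ ynT]].
have yk : form (g k) y <= 0.
  rewrite leNgt; apply/negP => yk; apply: ynT; apply: JP => j jJ.
  by have [->//|jk] := eqVneq j k; apply: yJ; rewrite !inE jk.
have x0k : 0 < form (g k) x0 by apply: x0P.
(* The point where the segment from x0 to y crosses the kernel of g k, up to a
   positive factor. *)
pose z := form (g k) x0 *: y - form (g k) y *: x0.
have zk : form (g k) z = 0 by rewrite formD formN !formZ; ring.
have zJ : cone (J :\ k) z.
  move=> j jJ; have := yJ j jJ; have := x0P (finset.in_setT j).
  rewrite formD formN !formZ; nra.
have nonneg w : form (g k) w = 0 -> cone (J :\ k) w ->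
    forall i, 0 <= form (g i) w.
  move=> wk wJ i; rewrite leNgt; apply/negP => wi.
  have x0i : 0 < form (g i) x0 by apply: x0P.
  (* If g i were negative at w, the segment from x0 to w would leave the cone
     at this point, which nevertheless satisfies all inequalities of J. *)
  have : cone J (form (g i) x0 *: w - form (g i) w *: x0).
    move=> j jJ; rewrite formD formN !formZ.
    have x0j : 0 < form (g j) x0 by apply: x0P.
    have [->|jk] := eqVneq j k; first by rewrite wk; nra.
    have : 0 < form (g j) w by apply: wJ; rewrite !inE jk.
    nra.
  move/JP/(_ i (finset.in_setT _)).
  by rewrite formD formN !formZ mulrC subrr ltxx.
exists z => // i ik; rewrite lt_def nonneg // andbT; apply/negP => /eqP zi.
have [d dk di] := g_indep ik.
have zJ' j : j \in enum (J :\ k) -> 0 < form (g j) z.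
  by rewrite mem_enum => /zJ.
have [e e0 eP] := perturb_pos (fun j => form (g j) d) zJ'.
have : 0 <= form (g i) (z + e *: d).
  apply: nonneg; first by rewrite formD formZ zk dk mulr0 addr0.
  by move=> j jJ; rewrite formD formZ; apply: eP; rewrite mem_enum.
by rewrite formD formZ zi add0r pmulr_rge0 // leNgt di.
Qed.

(** If v is killed by all facet forms, the line through x0 with direction v
    stays in the cone by [cone_facets]; a form that is positive on a whole line
    is constant on it, so v is killed by all forms and is 0. *)
Lemma row_free_facets m (e : 'I_m -> I) :
  (forall i, i \in facets -> exists l, e l = i) ->
  row_free (\matrix_(i < r, l < m) g (e l) i 0).
Proof.
move=> eF; set G := \matrix_(i, j) _.
have GE x l : (x *m G) 0 l = form (g (e l)) x.
  by rewrite /form !mxE; apply: eq_bigr => i _; rewrite mxE.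
apply/inj_row_free => v vG.
have vF i : i \in facets -> form (g i) v = 0.
  by case/eF => j <-; rewrite -GE vG mxE.
apply: g_ess => i; apply/eqP; rewrite eq_le leNgt [X in _ && X]leNgt.
have x0i : 0 < form (g i) x0 by apply: x0P.
have line a : 0 < form (g i) x0 + a * form (g i) v.
  rewrite -formZ -formD; apply: cone_facets => // j jF.
  by rewrite formD formZ vF // mulr0 addr0; apply: x0P.
apply/andP; split; apply/negP => vi.
  have := line (- form (g i) x0 / form (g i) v).
  by rewrite divfK ?gt_eqF // subrr ltxx.
have := line (- form (g i) x0 / form (g i) v).
by rewrite divfK ?lt_eqF // subrr ltxx.
Qed.

Lemma card_facets_ge : (r <= #|facets|)%N.
Proof.
have /eqP <- : row_free (\matrix_(i < r, l < #|facets|) g (enum_val l) i 0).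
  apply: row_free_facets => i iF; exists (enum_rank_in iF i).
  exact: enum_rankK_in.
exact: rank_leq_col.
Qed.

(** If there are exactly r facet forms, they are a basis of the dual space, and
    the cone is spanned by the dual basis. *)
Lemma facets_simplicial : #|facets| = r ->
  exists2 b : r.-tuple 'rV[R]_r, basis_of fullv b &
    forall x, cone [set: I] x <->
      exists2 a : 'I_r -> R, (forall i, 0 < a i) & x = \sum_(i < r) a i *: b`_i.
Proof.
move=> Fr; pose e (j : 'I_r) : I := enum_val (cast_ord (esym Fr) j).
have eF i : i \in facets -> exists l, e l = i.
  move=> iF; exists (cast_ord Fr (enum_rank_in iF i)).
  by rewrite /e cast_ordK enum_rankK_in.
have := row_free_facets eF; set G := \matrix_(i, j) _.
rewrite row_free_unit => Gu.
have GE x l : (x *m G) 0 l = form (g (e l)) x.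
  by rewrite /form !mxE; apply: eq_bigr => i _; rewrite mxE.
pose b := [tuple row l (invmx G) | l < r].
have bE (a : 'rV[R]_r) : \sum_(i < r) a 0 i *: b`_i = a *m invmx G.
  rewrite mulmx_sum_row; apply: eq_bigr => i _.
  by rewrite -tnth_nth tnth_mktuple.
exists b.
  rewrite basisEdim size_tuple dimvf /dim /= mul1n leqnn andbT.
  apply/subvP => v _; rewrite -[v](mulmxK Gu) -bE; apply: rpred_sum => i _.
  by apply/rpredZ/memv_span/mem_nth; rewrite size_tuple.
move=> x; split=> [xP|[a a0 xE] i _].
  exists (fun i => (x *m G) 0 i) => [i|]; first by rewrite GE; apply: xP.
  by rewrite bE mulmxK.
suff : cone facets x by move/cone_facets; apply.
move=> k /eF[j <-]; rewrite -GE xE.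
have -> : \sum_(i < r) a i *: b`_i = (\row_i a i) *m invmx G.
  by rewrite -bE; apply: eq_bigr => l _; rewrite mxE.
by rewrite mulmxKV // mxE.
Qed.

End Facets.

(** * Hyperplanes as kernels of linear forms *)

Section HyperplaneForm.
Variables (R : realFieldType) (r : nat).

(** Project onto a complementary line L along H and read off a coordinate that
    does not vanish on L. *)
Lemma hyperplane_form (H : {vspace 'rV[R]_r}) : linear_hyperplane fullv H ->
  exists u : 'cV[R]_r, forall x, (x \in H) = (form u x == 0).
Proof.
move=> /andP[_ /eqP dH]; pose L := (H^C)%VS.
have LH0 : (L :&: H = 0)%VS by rewrite capvC capv_compl.
have HLT x : x \in (L + H)%VS by rewrite addvC addv_complf memvf.
have L1 : \dim L = 1%N by rewrite dimv_compl -dH subSnn.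
have L0 : L != 0%VS by rewrite -dimv_eq0 L1.
set w := vpick L; have w0 : w != 0 by rewrite vpick0.
have Lw y : y \in L -> exists a, y = a *: w.
  have /eqP <- : (<[w]> == L)%VS.
    by rewrite eqEdim L1 dim_vline w0 -memvE memv_pick.
  by move=> /vlineP.
have [j wj] : exists j, w 0 j != 0.
  apply/existsP; apply: contraNT w0 => /existsPn w0; apply/eqP/rowP => j.
  by rewrite mxE; apply/eqP/negPn/w0.
pose pi := daddv_pi L H.
exists (col j (lin1_mx pi)) => x.
have -> : form (col j (lin1_mx pi)) x = (pi x) 0 j.
  rewrite -[pi x](mul_rV_lin1 pi) /form !mxE.
  by apply: eq_bigr => i _; rewrite [col _ _ _ _]mxE.
have xE : pi x + daddv_pi H L x = x by rewrite daddv_pi_add.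
apply/idP/eqP => [xH|].
  have : pi x = 0.
    apply: (addIr (daddv_pi H L x)).
    by rewrite xE add0r daddv_pi_id // capvC.
  by move->; rewrite mxE.
have [a piE] := Lw (pi x) (memv_pi _ _ _).
rewrite piE mxE => /eqP; rewrite mulf_eq0 (negPf wj) orbF => /eqP a0.
by rewrite -xE piE a0 scale0r add0r memv_pi.
Qed.

End HyperplaneForm.

(** * Chambers are the nonempty sign regions *)

Section Regions.
Variables (R : realType) (r : nat).
Local Open Scope classical_set_scope.

Lemma form_continuous (u : 'cV[R]_r) : continuous (form u : 'rV[R]_r -> R).
Proof.
have -> : form u = fun x : 'rV[R]_r => \sum_i x 0 i * u i 0.
  by apply/funext => x; rewrite /form mxE.
elim: (index_enum _) => [|i t IH] x.
  have -> : (fun y : 'rV[R]_r => \sum_(j <- [::]) y 0 j * u j 0) = cst 0.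
    by apply/funext => y; rewrite big_nil.
  exact: cst_continuous.
have -> : (fun y : 'rV[R]_r => \sum_(j <- i :: t) y 0 j * u j 0) =
    (fun y => y 0 i * u i 0 + \sum_(j <- t) y 0 j * u j 0).
  by apply/funext => y; rewrite big_cons.
have ci := @coord_continuous R 1 r 0 i x.
exact: cvgD (cvgM ci (cvg_cst (u i 0))) (IH x).
Qed.

Variables (A : {fset {vspace 'rV[R]_r}}) (f : A -> 'cV[R]_r).
Hypothesis fP : forall (i : A) x, (x \in val i) = (form (f i) x == 0).

Lemma arr_complementP x :
  arr_complement A x <-> forall i : A, form (f i) x != 0.
Proof.
split=> [nx i|nx [H HA xH]].
  rewrite -fP; apply/negP => xi; apply: nx.
  by exists (val i) => //; apply: valP.
by have := nx [` HA]%fset; rewrite -fP xH.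
Qed.

Definition region (s : {ffun A -> bool}) : set 'rV[R]_r :=
  [set x | forall i, 0 < side_value f s i x].

Lemma region_complement s : region s `<=` arr_complement A.
Proof.
move=> x xs; apply/arr_complementP => i; apply/eqP => xi.
by have := xs i; rewrite /side_value formZl xi mulr0 ltxx.
Qed.

Lemma complement_region x : arr_complement A x -> exists s, region s x.
Proof.
move/arr_complementP => xA; exists [ffun i => form (f i) x < 0] => i.
rewrite /side_value formZl ffunE; have := xA i; rewrite neq_lt.
by case: ltP => //= [xi _|_ xi]; rewrite ?expr1 ?expr0 ?mul1r ?mulN1r ?oppr_gt0.
Qed.

(** The linear forms cannot change sign on a connected subset of the complement,
    by the intermediate value theorem, and a region contains the segments
    between its points. *)
Lemma component_region s x : region s x ->
  connected_component (arr_complement A) x = region s.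
Proof.
move=> xs; have xA := region_complement xs; apply/seteqP; split=> y.
  move=> yC i; rewrite ltNge; apply/negP => yi.
  have : connected
      (side_value f s i @` connected_component (arr_complement A) x).
    apply: connected_continuous_connected; first exact: component_connected.
    by apply: continuous_subspaceT => z; apply: form_continuous.
  move/connected_intervalP => itv.
  have [z zC zi] :
      (side_value f s i @` connected_component (arr_complement A) x) 0.
    apply: (itv (side_value f s i y) (side_value f s i x)); first by exists y.
      by exists x => //; apply: connected_component_refl.
    by rewrite yi ltW // xs.
  have /arr_complementP/(_ i)/eqP := connected_component_sub zC; apply.
  move: zi; rewrite /side_value formZl => /eqP.
  by rewrite mulf_eq0 signr_eq0 => /eqP.
move=> ys; pose seg (t : R) := x + t *: (y - x).
have : (seg @` `[0, 1]) `<=` connected_component (arr_complement A) x.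
  apply: connected_component_max.
  - by exists 0; rewrite /= ?in_itv /= ?lexx ?ler01 // /seg scale0r addr0.
  - move=> _ [t + <-]; rewrite /= in_itv /= => /andP[t0 t1].
    apply: (@region_complement s) => i; have := xs i; have := ys i.
    rewrite /seg /side_value formD formZ formD formN; nra.
  - apply: connected_continuous_connected; first exact: segment_connected.
    apply: continuous_subspaceT => t.
    apply: cvgD; first exact: cvg_cst.
    exact: scalel_continuous.
apply; exists 1; first by rewrite /= in_itv /= lexx ler01.
by rewrite /seg scale1r addrC subrK.
Qed.

End Regions.

(** * Double counting of chambers and facets *)

Section Counting.
Variables (R : realType) (r : nat) (A : {fset {vspace 'rV[R]_r}}).
Hypothesis Acentral : central_arrangement fullv A.
Hypothesis Aessential : essential fullv A.
Variable f : A -> 'cV[R]_r.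
Hypothesis fP : forall (i : A) x, (x \in val i) = (form (f i) x == 0).

Let hyperplaneA (i : A) : linear_hyperplane fullv (val i).
Proof. exact/Acentral/valP. Qed.

Definition sign_vectors : {set {ffun A -> bool}} :=
  [set s : {ffun A -> bool} | `[< exists x, region f s x >]].

Definition oriented (s : {ffun A -> bool}) (i : A) := (-1) ^+ s i *: f i.

Lemma cone_region s x : cone (oriented s) [set: A] x <-> region f s x.
Proof. by split=> [xs i|xs i _]; apply: xs; rewrite ?finset.in_setT. Qed.

Lemma oriented_indep s i k : i != k ->
  exists2 d, form (oriented s k) d = 0 & form (oriented s i) d < 0.
Proof.
move=> ik; have : ~~ (val k <= val i)%VS.
  apply: contra ik => ki; have /andP[_ /eqP di] := hyperplaneA i.
  have /andP[_ /eqP dk] := hyperplaneA k.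
  by apply/eqP/val_inj/esym/eqP; rewrite eqEdim ki -ltnS di dk /=.
case/subvPn => d; rewrite !fP => /eqP dk di.
have : form (oriented s i) d != 0 by rewrite formZl mulf_neq0 ?signr_eq0.
rewrite neq_lt => /orP[lt|gt]; [exists d|exists (- d)] => //.
- by rewrite formZl dk mulr0.
- by rewrite formN formZl dk mulr0 oppr0.
- by rewrite formN oppr_lt0.
Qed.

Lemma oriented_ess s v : (forall i, form (oriented s i) v = 0) -> v = 0.
Proof.
move=> v0; apply/eqP; rewrite -memv0 -Aessential mem_arr_meet memvf /=.
apply/allP => H HA; have := v0 [` HA]%fset; rewrite formZl => /eqP.
by rewrite mulf_eq0 signr_eq0 /= -fP.
Qed.

Lemma simplicial_card_facets :
  simplicial A <-> forall s, s \in sign_vectors -> #|facets (oriented s)| = r.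
Proof.
split=> [simp s|Fr C [x xA ->]].
  rewrite inE => /asboolP[x xs].
  have x0P : cone (oriented s) [set: A] x by apply/cone_region.
  apply/eqP; rewrite eqn_leq.
  rewrite (card_facets_ge (@oriented_indep s) (@oriented_ess s) x0P) andbT.
  have [|b bB Cb] := simp (connected_component (arr_complement A) x).
    by exists x => //; apply: region_complement xs.
  apply: (card_facets_simplicial bB) => y; rewrite cone_region.
  by rewrite (component_region fP xs) in Cb; rewrite Cb.
have [s xs] := complement_region fP xA.
have sS : s \in sign_vectors by rewrite inE; apply/asboolP; exists x.
have x0P : cone (oriented s) [set: A] x by apply/cone_region.
have [b bB bP] :=
  facets_simplicial (@oriented_indep s) (@oriented_ess s) x0P (Fr s sS).
exists b => //; rewrite (component_region fP xs).
by apply/seteqP; split=> y /=; rewrite -cone_region bP.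
Qed.

Lemma card_sign_vectors :
  #|sign_vectors|%:R = (-1) ^+ r * (char_poly_arr fullv A).[-1].
Proof.
have eA : map val (enum {: A}) =i A.
  move=> H; apply/mapP/idP => [[i _ ->]|HA]; first exact: valP.
  by exists [` HA]%fset; rewrite ?mem_enum.
rewrite (char_poly_whitney _ Acentral eA).
have := zaslavsky fP hyperplaneA fullv (enum_uniq {: A}).
rewrite dimvf /dim /= mul1n -cardE natrM => /mulfI <- //.
congr (_%:R); apply: eq_card => s; rewrite !inE; apply: asbool_equiv_eq.
by split=> [[x xs]|[x _ xs]]; exists x; rewrite ?memvf // => i; apply: xs;
   rewrite mem_enum.
Qed.

Lemma mem_rem_enum (i j : A) : (j \in rem i (enum {: A})) = (j != i).
Proof. by rewrite mem_rem_uniq ?enum_uniq // !inE mem_enum andbT. Qed.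

(** The regions of the restriction to a hyperplane are the facets it contains,
    each of which belongs to the two chambers on its sides. *)
Lemma card_facet_pairs (i : A) :
  #|[set s : {ffun A -> bool} | i \in facets (oriented s)]|%:R =
  2 * ((-1) ^+ r.-1 * (char_poly_arr (val i) (restriction A (val i))).[-1]).
Proof.
pose js := rem i (enum {: A}).
have memjs j : (j \in js) = (j != i) by apply: mem_rem_enum.
have sA : map val js =i [predD1 A & val i].
  move=> H; rewrite inE; apply/mapP/andP => [[j + ->]|[neq HA]].
    by rewrite memjs => ji; split; [rewrite (inj_eq val_inj)|apply: valP].
  by exists [` HA]%fset; rewrite // memjs -(inj_eq val_inj).
rewrite (char_poly_restriction _ Acentral (valP i) sA).
have dimi : \dim (val i) = r.-1.
  have /andP[_ /eqP] := hyperplaneA i; rewrite dimvf /dim /= mul1n => dimi.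
  by apply: succn_inj; rewrite dimi prednK // -dimi.
have szjs : #|{: A}| = (size js).+1.
  rewrite /js size_rem ?mem_enum // -cardE prednK //.
  by apply/card_gt0P; exists i.
have := zaslavsky fP hyperplaneA (val i) (rem_uniq i (enum_uniq {: A})).
rewrite dimi natrM szjs expnSr [(_ * 2)%:R]natrM -mulrA => /mulfI <- //.
congr (_%:R); apply: eq_card => s; rewrite !inE; apply: asbool_equiv_eq.
split=> -[x xi xs]; exists x.
- by move: xi => /eqP; rewrite fP formZl mulf_eq0 signr_eq0.
- by move=> j; rewrite memjs; apply: xs.
- by apply/eqP; rewrite formZl mulf_eq0 -fP xi orbT.
- by move=> j ji; apply: xs; rewrite memjs.
Qed.

(** Moving a facet point slightly to the prescribed side of its hyperplane
    gives a point of the region. *)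
Lemma facet_sign_vector s i : i \in facets (oriented s) -> s \in sign_vectors.
Proof.
rewrite !inE => -[x xi xP].
have [d di] : exists d, 0 < form (oriented s i) d.
  have : ~~ (fullv <= val i)%VS.
    have /andP[_ /eqP di] := hyperplaneA i.
    by apply/negP => /dimvS; rewrite -di ltnn.
  case/subvPn => d _; rewrite fP => di.
  have : form (oriented s i) d != 0 by rewrite formZl mulf_neq0 ?signr_eq0.
  rewrite neq_lt => /orP[lt|gt]; [exists (- d)|by exists d].
  by rewrite formN oppr_gt0.
have [e e0 eP] : exists2 e, 0 < e &
    forall j, j \in rem i (enum {: A}) ->
      0 < form (oriented s j) x + e * form (oriented s j) d.
  apply: perturb_pos => j.
  by rewrite mem_rem_enum; apply: xP.
exists (x + e *: d) => j; rewrite /side_value formD formZ.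
have [->|ji] := eqVneq j i; first by rewrite [form _ x]xi add0r mulr_gt0.
by apply: eP; rewrite mem_rem_enum.
Qed.

Lemma sum_card_facets :
  (\sum_(s in sign_vectors) #|facets (oriented s)| =
   \sum_(i : A) #|[set s : {ffun A -> bool} | i \in facets (oriented s)]|)%N.
Proof.
transitivity (\sum_s \sum_(i : A) (i \in facets (oriented s)))%N.
  rewrite [RHS](bigID (mem sign_vectors)) /= [X in (_ + X)%N]big1 ?addn0.
    by apply: eq_bigr => s _; rewrite -sum1_card big_mkcond.
  move=> s sN; rewrite big1 // => i _.
  by case: (boolP (i \in _)) => // /facet_sign_vector; rewrite (negPf sN).
rewrite exchange_big; apply: eq_bigr => i _ /=.
by rewrite -sum1_card [RHS]big_mkcond; apply: eq_bigr => s _; rewrite inE.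
Qed.

Lemma card_facets_sign_vectors_ge s : s \in sign_vectors ->
  (r <= #|facets (oriented s)|)%N.
Proof.
rewrite inE => /asboolP[x /cone_region xs].
exact: (card_facets_ge (@oriented_indep s) (@oriented_ess s) xs).
Qed.

End Counting.

Theorem corollary2p4 (R : realType) (r : nat) (hr : (2 <= r)%N)
    (A : {fset {vspace 'rV[R]_r}})
    (Acentral : central_arrangement fullv A)
    (Aessential : essential fullv A) :
  simplicial A <->
  r%:Z * (char_poly_arr fullv A).[-1]
    + 2 * \sum_(H <- A) (char_poly_arr H (restriction A H)).[-1] = 0.
Proof.
have [f fP] := choice (fun i : A => hyperplane_form (Acentral _ (valP i))).
rewrite (simplicial_card_facets Acentral Aessential fP).
set S := sign_vectors f; pose F s := #|facets (oriented f s)|.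
(* The left-hand side of the equation measures, up to sign, the total number of
   facets beyond r per chamber. *)
have excess : (-1) ^+ r * (r%:Z * (char_poly_arr fullv A).[-1]
    + 2 * \sum_(H <- A) (char_poly_arr H (restriction A H)).[-1])
    = - (\sum_(s in S) (F s - r))%:R.
  rewrite sumnB; last by move=> s; apply: card_facets_sign_vectors_ge.
  rewrite natrB; last first.
    by apply: leq_sum => s; apply: card_facets_sign_vectors_ge.
  rewrite (sum_card_facets Acentral fP) sum_nat_const natrM natr_sum.
  rewrite (card_sign_vectors Acentral fP) big_seq_fsetE.
  rewrite (eq_bigr _ (fun i _ => card_facet_pairs Acentral fP i)).
  have sgnr : (-1) ^+ r = - (-1) ^+ r.-1 :> int.
    by case: (r) hr => // n _; rewrite exprS mulN1r.
  rewrite -2!mulr_sumr sgnr natz; ring.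
transitivity ((\sum_(s in S) (F s - r))%N = 0%N).
  split=> [Fr|/eqP]; first by rewrite big1 // => s sS; rewrite /F Fr // subnn.
  rewrite sum_nat_eq0 => /forall_inP Fr s sS; apply/eqP.
  by rewrite eqn_leq -subn_eq0 Fr // card_facets_sign_vectors_ge.
split=> [E0|E0].
  by apply/eqP; have /eqP := excess; rewrite E0 oppr0 mulf_eq0 signr_eq0.
by apply/eqP; have /eqP := excess; rewrite E0 mulr0 eq_sym oppr_eq0 pnatr_eq0.
Qed.
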